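(* Let the system $S$ be a register of $n$ qubits, $\mathcal H_S=(\mathbb C^2)^{\otimes n}$, coupled to a bath with finite-dimensional Hilbert space $\mathcal H_B$ and initial bath state $|\varphi_0\rangle\in\mathcal H_B$. Let the perturbation $V$ be a Hermitian operator on $\mathcal H_S\otimes\mathcal H_B$, written as $$V=\sum_{\alpha} c^\alpha P^\alpha\otimes B^\alpha ,$$ with $c^\alpha$ real, $P^\alpha\in\{\mathbf 1,\sigma^x,\sigma^y,\sigma^z\}^{\otimes n}$ and $B^\alpha$ operators on $\mathcal H_B$. Assume that adding a qubit does not change how the former qubits couple to the bath, so that $c^\alpha$ and $B^\alpha$ do not depend on $n$. Assume moreover that $V$ acts $k$-locally on the system: every system operator occurring in $V$ acts non-trivially on no more than $k$ qubits, with $k$ independent of $n$. Then $V$ contains $O(n^k)$ terms, and for an initial system state $|\psi\rangle$ in a decoherence-free subspace of the unperturbed Hamiltonian $H_0$, the dynamical fidelity susceptibility $\chi$ under the perturbation $H_0+\varepsilon V$ satisfies $$\chi=O(n^{2k}).$$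
   Context: A Pauli string on $n$ qubits is identified with the string on $n+1$ qubits obtained by appending $\mathbf 1$ on the added qubit; ''$c^\alpha$ and $B^\alpha$ do not depend on $n$'' means that the coefficient and bath operator attached to a given string stay the same when qubits are added. Unperturbed Hamiltonians have the form $H_0=H_S\otimes\mathbf 1+\mathbf 1\otimes H_B+H_{SB}$, where $H_S$ acts on the system, $H_B$ on the bath, and $H_{SB}$ is a system-bath interaction. Units with $\hbar=1$. For real $\varepsilon$ and $t\ge0$, put $H=H_0+\varepsilon V$ and, with $|\Psi\rangle=|\psi\rangle\otimes|\varphi_0\rangle$ and unit vectors $|\psi\rangle$, $|\varphi_0\rangle$, $\rho_S(\varepsilon,t)=\mathrm{tr}_B(e^{-itH}|\Psi\rangle\langle\Psi|e^{itH})$, where $\mathrm{tr}_B$ is the partial trace over $\mathcal H_B$. A decoherence-free subspace (for $H_0$ and $|\varphi_0\rangle$) is a subspace $D\subset\mathcal H_S$ such that for all unit vectors $|\psi\rangle\in D$ and all $t\ge0$ one has $\rho_S(0,t)=e^{-itH_S}|\psi\rangle\langle\psi|e^{itH_S}$ and $e^{-itH_S}|\psi\rangle\in D$. The dynamical fidelity is $F=F[\rho_S(0,t),\rho_S(\varepsilon,t)]$, where $F(\sigma,\eta)=\left[\mathrm{tr}\sqrt{\sqrt\sigma\,\eta\,\sqrt\sigma}\right]^2$; for $|\psi\rangle$ in a decoherence-free subspace it equals $\langle\psi|e^{itH_S}\rho_S(\varepsilon,t)e^{-itH_S}|\psi\rangle$. The dynamical fidelity susceptibility is $\chi=-\frac14\frac{\partial^2}{\partial\varepsilon^2}\frac{\partial^2F}{\partial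 t^2}\big|_{\varepsilon=t=0}$.
   Formalization: The formal theorem also assumes that all c^α B^α are bounded uniformly in n and α; independence of n alone permits couplings 2^j σ^x on qubit j, for which χ grows exponentially. *)

(* Defs.v *)
(* MathComp and MathComp-Analysis; R[i] (complex R) is the field of complex
   numbers over R : realType.  An operator on C^m is a matrix 'M[R[i]]_m acting
   on column vectors, and the tensor product is the Kronecker product *t. *)
From HB Require Import structures.
From mathcomp Require Import all_boot all_order all_algebra.
From mathcomp Require Import complex mxtens.
From mathcomp Require Import boolp classical_sets reals topology normedtype.
From mathcomp Require Import sequences derive.

Set Implicit Arguments.
Unset Strict Implicit.
Unset Printing Implicit Defensive.

Import Order.TTheory GRing.Theory Num.Theory numFieldNormedType.Exports.

Local Open Scope ring_scope.
Local Open Scope classical_set_scope.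
Local Open Scope complex_scope.
Local Open Scope sesquilinear_scope.

Inductive pauli := PauliI | PauliX | PauliY | PauliZ.

Definition pauli_code (p : pauli) : 'I_4 :=
  match p with
  | PauliI => inord 0 | PauliX => inord 1 | PauliY => inord 2 | PauliZ => inord 3
  end.

Definition pauli_decode (i : 'I_4) : pauli :=
  match val i with
  | 0%N => PauliI | 1%N => PauliX | 2%N => PauliY | _ => PauliZ
  end.

Lemma pauli_codeK : cancel pauli_code pauli_decode.
Proof. by case; rewrite /pauli_decode /= inordK. Qed.

HB.instance Definition _ := Finite.copy pauli (can_type pauli_codeK).

(* Number of qubits on which the string acts non-trivially. *)
Definition pauli_weight (n : nat) (a : n.-tuple pauli) : nat :=
  count (fun p => p != PauliI) a.

Section Operators.
Variable R : realType.
Local Notation C := R[i].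

Definition mx2 (a b c d : C) : 'M[C]_2 :=
  \matrix_(i, j) if i == 0 then (if j == 0 then a else b)
                 else (if j == 0 then c else d).

Definition pauli_mx (p : pauli) : 'M[C]_2 :=
  match p with
  | PauliI => 1%:M
  | PauliX => mx2 0 1 1 0
  | PauliY => mx2 0 (- 'i) 'i 0
  | PauliZ => mx2 1 0 0 (- 1)
  end.

(* P^a as an operator on (C^2)^{(x) n} = C^(2^n); the cast only identifies
   2 * 2^n with 2^(n+1), and the head of the string is the leftmost factor. *)
Fixpoint pauli_string (n : nat) : n.-tuple pauli -> 'M[C]_(2 ^ n) :=
  match n with
  | 0 => fun _ => 1%:M
  | n'.+1 => fun a =>
      castmx (esym (expnS 2 n'), esym (expnS 2 n'))
        (pauli_mx (thead a) *t pauli_string (behead_tuple a))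
  end.

(* The data a |-> c^a, B^a is given for every number n of qubits. *)
Section Perturbation.
Variables (d : nat) (c : forall n, n.-tuple pauli -> R)
          (B : forall n, n.-tuple pauli -> 'M[C]_d).

(* [rcons_tuple a PauliI] is the string a on one more qubit. *)
Definition size_independent : Prop :=
  forall n (a : n.-tuple pauli),
    c (rcons_tuple a PauliI) = c a /\ B (rcons_tuple a PauliI) = B a.

(* The system operator P^a (which is nonzero) occurs in V. *)
Definition occurs (n : nat) (a : n.-tuple pauli) : bool :=
  (c a)%:C *: B a != 0.

Definition k_local (k : nat) : Prop :=
  forall n (a : n.-tuple pauli), occurs a -> (pauli_weight a <= k)%N.

(* Size independence alone allows couplings such as c^a = 2^j for sigma^x on
   qubit j, for which the susceptibility grows exponentially in n; a polynomial
   bound needs the strengths of all couplings to be O(1).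
   `|_| is the largest modulus of the entries; as d is fixed, boundedness does
   not depend on the norm chosen on the bath operators. *)
Definition bounded_couplings : Prop :=
  exists M : R, forall n (a : n.-tuple pauli), `| (c a)%:C *: B a | <= M%:C.

Definition perturbation (n : nat) : 'M[C]_(2 ^ n * d) :=
  \sum_(a : n.-tuple pauli) (c a)%:C *: (pauli_string a *t B a).

End Perturbation.

Definition hermitian_op (m : nat) (A : 'M[C]_m) : Prop := A ^t* = A.

Definition unit_vector (m : nat) (v : 'cV[C]_m) : Prop := v ^t* *m v = 1%:M.

Definition ketbra (m : nat) (v : 'cV[C]_m) : 'M[C]_m := v *m v ^t*.

Definition expmx (m : nat) (A : 'M[C]_m) : 'M[C]_m :=
  limn (series (fun j => (j`!)%:R^-1 *: A ^+ j)).

(* e^{-itH} *)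
Definition evolution (m : nat) (H : 'M[C]_m) (t : R) : 'M[C]_m :=
  expmx (- ('i * t%:C) *: H).

(* Square root by the spectral decomposition A = U^-1 diag(s) U, U unitary,
   which holds for normal A; it is only applied to positive semidefinite A. *)
Definition sqrtmx (m : nat) (A : 'M[C]_m) : 'M[C]_m :=
  invmx (spectralmx A) *m diag_mx (map_mx sqrtC (spectral_diag A))
    *m spectralmx A.

(* The trace is real, so that complex.Re only changes its type. *)
Definition fidelity (m : nat) (sigma eta : 'M[C]_m) : R :=
  complex.Re ((\tr (sqrtmx (sqrtmx sigma *m eta *m sqrtmx sigma))) ^+ 2).

Section SystemBath.
Variables m d : nat.

Definition partial_trace_bath (A : 'M[C]_(m * d)) : 'M[C]_m :=
  \matrix_(i, j) \sum_(l < d) A (mxtens_index (i, l)) (mxtens_index (j, l)).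

Definition free_hamiltonian (HS : 'M[C]_m) (HB : 'M[C]_d)
    (HSB : 'M[C]_(m * d)) : 'M[C]_(m * d) :=
  HS *t (1%:M : 'M_d) + (1%:M : 'M_m) *t HB + HSB.

(* tr_B (e^{-itH} |Psi><Psi| e^{itH}), with Psi = psi (x) phi0. *)
Definition reduced_state (H : 'M[C]_(m * d)) (psi : 'cV[C]_m) (phi0 : 'cV[C]_d)
    (t : R) : 'M[C]_m :=
  partial_trace_bath
    (evolution H t *m ketbra (psi *t phi0) *m evolution H (- t)).

Definition decoherence_free (HS : 'M[C]_m) (HB : 'M[C]_d)
    (HSB : 'M[C]_(m * d)) (phi0 : 'cV[C]_d) (D : {vspace 'cV[C]_m}) : Prop :=
  forall psi : 'cV[C]_m, psi \in D -> unit_vector psi ->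
  forall t : R, 0 <= t ->
    reduced_state (free_hamiltonian HS HB HSB) psi phi0 t
      = evolution HS t *m ketbra psi *m evolution HS (- t)
    /\ evolution HS t *m psi \in D.

Definition dynamical_fidelity (H0 V : 'M[C]_(m * d)) (psi : 'cV[C]_m)
    (phi0 : 'cV[C]_d) (eps t : R) : R :=
  fidelity (reduced_state H0 psi phi0 t)
           (reduced_state (H0 + eps%:C *: V) psi phi0 t).

(* The formula for the fidelity makes sense for t of either sign and is smooth
   when psi lies in a decoherence-free subspace, so that the two-sided derivative
   at t = 0 is the one taken over t >= 0. *)
Definition susceptibility (H0 V : 'M[C]_(m * d)) (psi : 'cV[C]_m)
    (phi0 : 'cV[C]_d) : R :=
  - (4^-1) *
    derive1n 2 (fun eps : R^o =>
      derive1n 2 (fun t : R^o =>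
        dynamical_fidelity H0 V psi phi0 eps t : R^o) 0) 0.

End SystemBath.
End Operators.

(* Main.v *)
Require Import Defs.
From mathcomp Require Import all_boot all_order all_algebra.
From mathcomp Require Import complex mxtens.
From mathcomp Require Import boolp classical_sets functions reals interval_inference.
From mathcomp Require Import topology normedtype.
From mathcomp Require Import sequences derive realfun trigo.
From mathcomp Require Import ring lra.
Import Order.TTheory GRing.Theory Num.Theory numFieldNormedType.Exports.

Set Implicit Arguments.
Unset Strict Implicit.
Unset Printing Implicit Defensive.

Local Open Scope ring_scope.
Local Open Scope classical_set_scope.
Local Open Scope complex_scope.
Local Open Scope sesquilinear_scope.

(** Write Pi_t for the projector (|psi_t><psi_t|) (x) 1, where psi_t is the
    unperturbed system state.  As the unperturbed reduced state is pure, the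
    fidelity at t >= 0 is 1 - |w|^2, where w = (1 - Pi_t) e^{-itH} Psi is the
    leakage of the perturbed state.  The unperturbed leakage vanishes for
    t >= 0, hence so does its derivative at t = 0, so that the perturbed
    leakage has derivative -i eps (1 - Pi_0) V Psi there and the fidelity is
    1 - eps^2 t^2 |(1 - Pi_0) V Psi|^2 + O(t^3).  Thus chi is at most
    |V Psi|^2.  V is a sum of at most (4n)^k strings, and each P^a is unitary
    while c^a B^a is bounded uniformly in n and a.

    The decoherence-free hypothesis says nothing about t < 0.  Instead of
    extending it by analyticity, we use that a two-sided derivative which exists
    equals the one-sided derivative, and that [derive1] is 0 wherever it does
    not exist: the second t-derivative at 0 is then either the expected
    multiple of eps^2 or 0, which is enough to bound the outer derivative. *)

(** * One-sided information on second derivatives *)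

Section RealDerivatives.
Variable R : realType.
Implicit Types f g p : R -> R.

(* The limit of a divergent filter is the default value 0, so that [derive1]
   is 0 wherever the derivative does not exist. *)
Lemma derive1_not_derivable f a : ~ derivable f a 1 -> derive1 f a = 0.
Proof. by move=> nd; rewrite derive1E /derive dvgP. Qed.

(** If the two-sided derivative exists, its difference quotients may be sampled at positive [h]
    only, where [f] and [p] agree. *)
Lemma derive1_eq_right f p a d : (forall t, a <= t -> f t = p t) ->
  is_derive a 1 p d -> derive1 f a = d \/ derive1 f a = 0.
Proof.
move=> fp dp; have [df|/derive1_not_derivable ->] := EM (derivable f a 1); last by right.
left; rewrite derive1E /derive cvg_at_rightE //.
rewrite -(derive_val (is_derive := dp)) /derive cvg_at_rightE; last exact: ex_derive.
congr (lim _); apply/seteqP.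
have E : \forall h \near (0:R)^'+,
  h^-1 *: ((f \o shift a) (h *: 1) - f a) = h^-1 *: ((p \o shift a) (h *: 1) - p a) :> R.
  near=> h; rewrite /= !fp // lerDr /GRing.scale /= mulr1 ltW //.
split; apply: near_eq_cvg => //.
by near do apply/esym.
Unshelve. all: by end_near. Qed.

(** The assumption [p1 0 = 0] makes both outcomes of [derive1_eq_right] at the origin equal; for
    [t > 0], [f] and [p] agree near [t]. So [derive1 f] coincides with [p1] on [t >= 0], and
    [derive1_eq_right] applies once more. *)
Lemma derive1n2_eq_right f p p1 d : (forall t, 0 <= t -> f t = p t) ->
  (forall t : R, is_derive t 1 p (p1 t)) -> p1 0 = 0 -> is_derive (0 : R) 1 p1 d ->
  derive1n 2 f 0 = d \/ derive1n 2 f 0 = 0.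
Proof.
move=> fp dp p10 dp1; apply: (@derive1_eq_right _ p1) dp1 => t.
rewrite le_eqVlt => /predU1P[<-|t0].
  by case: (derive1_eq_right fp (dp 0)) => ->.
rewrite -(derive_val (is_derive := dp t)) derive1E; apply: near_eq_derive.
near=> s; apply: fp; apply: ltW; near: s; exact: lt_nbhsr.
Unshelve. all: by end_near. Qed.

Lemma derive1_bound f c : (forall t, `|f t| <= c * `|t|) -> `|derive1 f 0| <= c.
Proof.
move=> fc.
have c0 : 0 <= c by have := le_trans (normr_ge0 _) (fc 1); rewrite normr1 mulr1.
have f0 : f 0 = 0 by apply/eqP; rewrite -normr_le0 (le_trans (fc 0)) // normr0 mulr0.
have [df|/derive1_not_derivable ->] := EM (derivable f 0 1); last by rewrite normr0.
rewrite derive1E; apply: (cvgr_to_le (cvg_norm df)).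
near=> h; rewrite /= f0 subr0 addr0 /GRing.scale /= mulr1 normrM normfV.
by rewrite ler_pdivrMl ?normr_gt0 1?mulrC ?fc //; near: h; exact: nbhs_dnbhs_neq.
Unshelve. all: by end_near. Qed.

(** The choice between the two values may change arbitrarily from point to point. It suffices to
    bound [derive1 f t] by [2 |a| |t|], since [derive1_bound] then handles the outer derivative. *)
Lemma derive1n2_quadratic_or_zero f a :
  (forall t, f t = a * t ^+ 2 \/ f t = 0) -> `|derive1n 2 f 0| <= 2 * `|a|.
Proof.
move=> fa; apply: derive1_bound => t.
change (`|derive1 f t| <= 2 * `|a| * `|t|).
have bound s : `|f s| <= `|a| * s ^+ 2.
  case: (fa s) => ->; last by rewrite normr0 mulr_ge0 ?sqr_ge0.
  by rewrite normrM [`|s ^+ 2|]ger0_norm ?sqr_ge0.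
have f0 : f 0 = 0 by case: (fa 0) => ->//; rewrite expr0n mulr0.
have [df|/derive1_not_derivable ->] := EM (derivable f t 1); last first.
  by rewrite normr0 !mulr_ge0.
have ctsf : {for t, continuous f}.
  by apply: differentiable_continuous; exact/derivable1_diffP.
have dq (s : R) : is_derive s 1 (fun x : R => a * x ^+ 2) (2 * a * s).
  have sq : is_derive s 1 (fun x : R => x ^+ 2) (2 * s).
    apply: DeriveDef; first exact: exprn_derivable.
    by rewrite exp_derive /GRing.scale /= mulr1 expr1 mulr_natl.
  have := is_deriveZ a sq => /is_derive_eq; apply.
  by rewrite /GRing.scale /= mulrA (mulrC a).
(* Where [a * t ^+ 2 = 0] continuity cannot separate the alternatives: either [a = 0] and [f]
   vanishes identically, or [t = 0] and the difference quotient is at most [|a| |h|]. *)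
have [at0|at0] := eqVneq (a * t ^+ 2) 0.
  have fz : f t = 0 by case: (fa t) => ->.
  rewrite [X in `|X|](_ : _ = 0) ?normr0 ?mulr_ge0 //.
  move/eqP: at0; rewrite mulf_eq0 expf_eq0 /= => /orP[/eqP a0|/eqP t0].
    have -> : f = (fun=> 0) by apply/funext => s; case: (fa s) => ->; rewrite ?a0 ?mul0r.
    exact: derive1_cst.
  rewrite t0 in df *; apply/eqP; rewrite -normr_le0 derive1E.
  have cvg0 : (fun h : R => `|a| * `|h|) @ 0^' --> `|a| * `|0 : R|.
    apply: cvg_within_filter; apply: cvgM; first exact: cvg_cst.
    by apply: cvg_norm; exact: cvg_id.
  rewrite normr0 mulr0 in cvg0.
  apply: (ler_cvg_to (cvg_norm df) cvg0).
  near=> h; have h0 : h != 0 by near: h; exact: nbhs_dnbhs_neq.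
  rewrite /= f0 subr0 addr0 /GRing.scale /= mulr1 normrM normfV.
  by rewrite ler_pdivrMl ?normr_gt0 // mulrCA -normrM -expr2 (ger0_norm (sqr_ge0 h)) bound.
(* Now [a * t ^+ 2 != 0], so continuity of [f] at [t] keeps the alternative taken there on a whole
   neighbourhood. *)
case: (fa t) => ft.
- have -> : derive1 f t = 2 * a * t.
    rewrite -(derive_val (is_derive := dq t)) derive1E; apply: near_eq_derive.
    have : \forall x \near t, f x != 0.
      by apply: cvgr_neq0 ctsf _; rewrite ft.
    by apply: filterS => x fx; case: (fa x) fx => // ->; rewrite eqxx.
  by rewrite !normrM ger0_norm.
- have -> : derive1 f t = 0.
    rewrite -[RHS](derive1_cst (0 : R) t) derive1E [RHS]derive1E; apply: near_eq_derive.
    have : \forall x \near t, f x - a * x ^+ 2 != 0.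
      have ctsq : {for t, continuous (fun x : R => a * x ^+ 2)}.
        by apply: differentiable_continuous; apply/derivable1_diffP; case: (dq t).
      by apply: cvgr_neq0 (cvgB ctsf ctsq) _; rewrite ft sub0r oppr_eq0.
    by apply: filterS => x; case: (fa x) => -> //; rewrite subrr eqxx.
  by rewrite normr0 !mulr_ge0.
Unshelve. all: by end_near. Qed.
End RealDerivatives.

(** * Counting Pauli strings *)

Section PauliCount.
Local Open Scope nat_scope.

Lemma card_pauli : #|{: pauli}| = 4.
Proof.
rewrite -(card_ord 4); apply: (bij_eq_card (f := pauli_code)).
exists pauli_decode; first exact: pauli_codeK.
move=> i; apply: val_inj; case: i => -[|[|[|[|//]]]] lt_i4 /=;
  by rewrite /pauli_decode /= inordK.
Qed.

Lemma pauli_weightE n (a : n.-tuple pauli) :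
  pauli_weight a = #|[pred i | tnth a i != PauliI]|.
Proof.
rewrite /pauli_weight -{1}(map_tnth_enum a) count_map cardE -size_filter; congr size.
by rewrite enumT; apply: eq_filter => i; rewrite inE.
Qed.

Definition pauli_update n (a : n.-tuple pauli) (i : 'I_n) p : n.-tuple pauli :=
  [tuple if j == i then p else tnth a j | j < n].

(** Resetting one non-identity letter to [PauliI] lowers the weight, and remembering that letter
    restores [a]. If there is none, [b = a] works with its own letter at position 0, which exists
    since [0 < n]. *)
Lemma pauli_weight_split n (a : n.-tuple pauli) k : 0 < n ->
  pauli_weight a <= k.+1 ->
  exists (b : n.-tuple pauli) i p, pauli_weight b <= k /\ a = pauli_update b i p.
Proof.
move=> n_gt0; rewrite pauli_weightE => wa.
have updK b i : (forall j, j != i -> tnth a j = tnth b j) ->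
    a = pauli_update b i (tnth a i).
  by move=> ab; apply: eq_from_tnth => j; rewrite tnth_mktuple; case: eqP => [->|/eqP/ab].
have [i /= ai|a0] := pickP [pred i | tnth a i != PauliI].
- exists (pauli_update a i PauliI), i, (tnth a i); split; last first.
    by apply: updK => j /negPf ji; rewrite tnth_mktuple ji.
  rewrite pauli_weightE -ltnS (leq_trans _ wa) // [X in _ < X](cardD1 i) inE ai.
  rewrite ltnS subset_leq_card //; apply/fintype.subsetP => j; rewrite !inE tnth_mktuple.
  by case: (j == i) => //=; rewrite eqxx.
- exists a, (Ordinal n_gt0), (tnth a (Ordinal n_gt0)); split; last exact: updK.
  by rewrite pauli_weightE (eq_card0 a0).
Qed.

(** By [pauli_weight_split], each further unit of weight costs a choice of position and letter,
    hence a factor of at most [4 * n]. *)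
Lemma card_pauli_weight_le n k : 0 < n ->
  #|[pred a : n.-tuple pauli | pauli_weight a <= k]| <= (4 * n) ^ k.
Proof.
move=> n_gt0; elim: k => [|k IHk].
  rewrite expn0; apply/card_le1P => a; rewrite inE leqn0 pauli_weightE => /eqP/card0_eq a0 b.
  rewrite !inE leqn0 pauli_weightE; apply/eqP/eqP => [/card0_eq b0|->]; last exact: eq_card0.
  apply: eq_from_tnth => i.
  by move: (a0 i) (b0 i); rewrite !inE => /negbFE/eqP -> /negbFE/eqP ->.
pose f (x : n.-tuple pauli * ('I_n * pauli)) := pauli_update x.1 x.2.1 x.2.2.
pose A : {set n.-tuple pauli} := [set a | pauli_weight a <= k]%SET.
apply: (@leq_trans #|f @: finset.setX A finset.setT|).
  apply: subset_leq_card; apply/fintype.subsetP => a /(pauli_weight_split n_gt0)[b [i [p [wb ->]]]].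
  by apply/imsetP; exists (b, (i, p)); rewrite // finset.in_setX !inE /= wb.
rewrite (leq_trans (leq_imset_card _ _)) // cardsX cardsT card_prod card_ord card_pauli.
by rewrite expnSr (mulnC n) leq_mul2r cardsE IHk orbT.
Qed.
End PauliCount.

(** * Adjoints, norms and the fidelity with a pure state *)

Section Adjoint.
Variable C : numClosedFieldType.

Lemma adjmxM m n p (A : 'M[C]_(m, n)) (B : 'M[C]_(n, p)) :
  (A *m B) ^t* = B ^t* *m A ^t*.
Proof. by rewrite trmx_mul map_mxM. Qed.

Lemma adjmxD m n (A B : 'M[C]_(m, n)) : (A + B) ^t* = A ^t* + B ^t*.
Proof. by rewrite linearD map_mxD. Qed.

Lemma adjmxN m n (A : 'M[C]_(m, n)) : (- A) ^t* = - A ^t*.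
Proof. by rewrite linearN map_mxN. Qed.

Lemma adjmxB m n (A B : 'M[C]_(m, n)) : (A - B) ^t* = A ^t* - B ^t*.
Proof. by rewrite adjmxD adjmxN. Qed.

Lemma adjmxZ m n a (A : 'M[C]_(m, n)) : (a *: A) ^t* = Num.conj a *: A ^t*.
Proof. by rewrite linearZ map_mxZ. Qed.

Lemma adjmx1 n : (1%:M : 'M[C]_n) ^t* = 1%:M.
Proof. by rewrite tr_scalar_mx map_scalar_mx rmorph1. Qed.

Lemma adjmx_tens m n p q (A : 'M[C]_(m, n)) (B : 'M[C]_(p, q)) :
  (A *t B) ^t* = A ^t* *t B ^t*.
Proof. by rewrite trmx_tens map_mxT. Qed.

(** Pythagoras for the orthogonal projector [P]: the cross terms cancel because [P] is self-adjoint
    and idempotent. *)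
Lemma adjmx_mul_self_proj n (P : 'M[C]_n) (v : 'cV[C]_n) : P ^t* = P -> P *m P = P ->
  v ^t* *m v = (P *m v) ^t* *m (P *m v) + (v - P *m v) ^t* *m (v - P *m v).
Proof.
move=> Ph PP; rewrite adjmxB mulmxBl !mulmxBr !adjmxM Ph !mulmxA -(mulmxA _ P P) PP.
by rewrite subrr subr0 addrC subrK.
Qed.

Lemma adjmx_mul_proj n (P : 'M[C]_n) (v : 'cV[C]_n) : P ^t* = P -> P *m P = P ->
  v ^t* *m (P *m v) = (P *m v) ^t* *m (P *m v).
Proof. by move=> Ph PP; rewrite adjmxM Ph -mulmxA (mulmxA P) PP. Qed.
End Adjoint.

Section StateVectors.
Variable R : realType.
Local Notation C := R[i].

Lemma adjmx_ketbra n (v : 'cV[C]_n) : (ketbra v) ^t* = ketbra v.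
Proof. by rewrite /ketbra adjmxM trmxCK. Qed.

Lemma ketbra_idem n (v : 'cV[C]_n) : unit_vector v ->
  ketbra v *m ketbra v = ketbra v.
Proof.
by move=> v1; rewrite /ketbra mulmxA -(mulmxA v) v1 mulmx1.
Qed.

(** The squared Euclidean norm, valued in [R] rather than [C] so that real order and real
    derivatives apply. *)
Definition sqnorm n (v : 'cV[C]_n) : R :=
  \sum_i (complex.Re (v i 0) ^+ 2 + complex.Im (v i 0) ^+ 2).

Lemma adjmx_mul_self n (v : 'cV[C]_n) : v ^t* *m v = (sqnorm v)%:C%:M.
Proof.
apply/matrixP => i j; rewrite !ord1 !mxE /= mulr1n rmorph_sum /=.
apply: eq_bigr => k _; rewrite !mxE.
by case: (v k 0) => a b; apply/eqP; rewrite eq_complex /=; apply/andP; split; apply/eqP; ring.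
Qed.

Lemma unit_vectorE n (v : 'cV[C]_n) : unit_vector v <-> sqnorm v = 1.
Proof.
rewrite /unit_vector adjmx_mul_self; split => [/matrixP/(_ 0 0)|->//].
by rewrite !mxE /= !mulr1n => -[].
Qed.

Lemma sqnorm_ge0 n (v : 'cV[C]_n) : 0 <= sqnorm v.
Proof. by apply: sumr_ge0 => i _; rewrite addr_ge0 ?sqr_ge0. Qed.

Lemma sqnorm0_eq0 n (v : 'cV[C]_n) : sqnorm v = 0 -> v = 0.
Proof.
move=> /eqP; rewrite psumr_eq0 => [/allP v0|i _]; last by rewrite addr_ge0 ?sqr_ge0.
apply/matrixP => i j; rewrite ord1 mxE; apply/eqP; rewrite eq_complex /=.
by have := v0 i (mem_index_enum i); rewrite paddr_eq0 ?sqr_ge0 // !expf_eq0.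
Qed.

Lemma sqnorm_isometry m n (U : 'M[C]_(m, n)) (v : 'cV[C]_n) :
  U ^t* *m U = 1%:M -> sqnorm (U *m v) = sqnorm v.
Proof.
move=> U1; have := adjmx_mul_self (U *m v).
rewrite adjmxM mulmxA -(mulmxA (v ^t*)) U1 mulmx1 adjmx_mul_self.
by move=> /matrixP/(_ 0 0); rewrite !mxE /= !mulr1n => -[].
Qed.

Lemma sqnorm_tens m n (u : 'cV[C]_m) (v : 'cV[C]_n) :
  sqnorm (u *t v : 'cV_(m * n)) = sqnorm u * sqnorm v.
Proof.
have E : (u *t v) ^t* *m (u *t v) = (sqnorm u)%:C%:M *t (sqnorm v)%:C%:M.
  by rewrite adjmx_tens tensmx_mul !adjmx_mul_self.
have /matrixP/(_ 0 0) := etrans (esym E) (adjmx_mul_self (u *t v : 'cV_(m * n))).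
by rewrite !mxE !ord1 /= !mulr1n -rmorphM /= => /complexI.
Qed.

Lemma sqnormZ n a (v : 'cV[C]_n) :
  sqnorm (a *: v) = (complex.Re a ^+ 2 + complex.Im a ^+ 2) * sqnorm v.
Proof.
rewrite /sqnorm mulr_sumr; apply: eq_bigr => i _; rewrite !mxE.
case: a => a b; case: (v i 0) => c d /=; ring.
Qed.

Lemma sqnorm_proj n (P : 'M[C]_n) (v : 'cV[C]_n) : P ^t* = P -> P *m P = P ->
  sqnorm v = sqnorm (P *m v) + sqnorm (v - P *m v).
Proof.
move=> Ph PP; apply: complexI; rewrite rmorphD /=.
have := adjmx_mul_self_proj v Ph PP; rewrite !adjmx_mul_self => /matrixP/(_ 0 0).
by rewrite !mxE /= !mulr1n.
Qed.

Lemma mxtrace_proj_ketbra n (P : 'M[C]_n) (v : 'cV[C]_n) : P ^t* = P -> P *m P = P ->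
  \tr (P *m ketbra v) = (sqnorm (P *m v))%:C.
Proof.
move=> Ph PP; rewrite /ketbra mulmxA mxtrace_mulC.
rewrite adjmx_mul_proj //.
by rewrite adjmx_mul_self mxtrace_scalar mulr1n.
Qed.

(** Cauchy-Schwarz against the constant 1, obtained by summing [x_a x_b <= (x_a^2 + x_b^2) / 2] over
    all pairs. *)
Lemma sqr_sum_le (I : finType) (A : {pred I}) (x : I -> R) :
  (\sum_(a in A) x a) ^+ 2 <= #|A|%:R * \sum_(a in A) x a ^+ 2.
Proof.
rewrite expr2 big_distrlr /=.
have le a b : x a * x b <= (x a ^+ 2 + x b ^+ 2) / 2.
  have := sqr_ge0 (x a - x b); lra.
apply: (@le_trans _ _ (\sum_(a in A) \sum_(b in A) (x a ^+ 2 + x b ^+ 2) / 2)).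
  by apply: ler_sum => a _; apply: ler_sum => b _.
rewrite (eq_bigr (fun a => (#|A|%:R * x a ^+ 2 + \sum_(b in A) x b ^+ 2) / 2)).
  by rewrite -mulr_suml big_split /= -mulr_sumr sumr_const -mulr_natl; lra.
by move=> a _; rewrite -mulr_suml big_split /= sumr_const mulr_natl.
Qed.

(** Apply [sqr_sum_le] to each real and imaginary coordinate. The squared cardinality is what turns
    [O(n^k)] terms into [O(n^(2k))]. *)
Lemma sqnorm_sum n (I : finType) (A : {pred I}) (v : I -> 'cV[C]_n) K :
  (forall a, a \in A -> sqnorm (v a) <= K) ->
  sqnorm (\sum_(a in A) v a) <= #|A|%:R ^+ 2 * K.
Proof.
move=> vK; apply: (@le_trans _ _ (#|A|%:R * \sum_(a in A) sqnorm (v a))).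
  rewrite /sqnorm exchange_big /= mulr_sumr; apply: ler_sum => i _.
  rewrite summxE !raddf_sum big_split mulrDr /=.
  by rewrite lerD // sqr_sum_le.
rewrite expr2 -mulrA ler_wpM2l ?ler0n //.
by apply: le_trans (ler_sum _ vK) _; rewrite sumr_const mulr_natl.
Qed.

Lemma sqrtC_divl (a : C) : (sqrtC a)^-1 * a = sqrtC a.
Proof.
rewrite -{2}(sqrtCK a) expr2.
by have [->|a0] := eqVneq (sqrtC a) 0; rewrite ?mulr0 // mulKf.
Qed.

(** Whatever spectral basis is chosen, [(a P)^2 = a (a P)] forces every eigenvalue to be 0 or [a].
    The root of the spectrum is thus the spectrum divided by [sqrtC a], and conjugating back returns
    a multiple of [P]. *)
Lemma sqrtmx_scale_proj n (a : C) (P : 'M[C]_n) : P ^t* = P -> P *m P = P ->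
  sqrtmx (a *: P) = sqrtC a *: P.
Proof.
move=> Ph PP; rewrite /sqrtmx; set U := spectralmx _; set s := spectral_diag _.
have nP : a *: P \is normalmx.
  by apply/normalmxP; rewrite adjmxZ Ph -!scalemxAl -!scalemxAr PP !scalerA mulrC.
have Uu : U \in unitmx by exact: spectral_unit.
have E : a *: P = invmx U *m diag_mx s *m U by exact/orthomx_spectralP.
have D : diag_mx s *m diag_mx s = a *: diag_mx s.
  have -> : diag_mx s = U *m (a *: P) *m invmx U.
    by rewrite E !mulmxA mulmxV // mul1mx -mulmxA mulmxV ?mulmx1.
  rewrite !mulmxA -(mulmxA _ (invmx U)) mulVmx // mulmx1.
  by rewrite -!mulmxA (mulmxA (a *: P)) -scalemxAl -scalemxAr PP -!scalemxAl -!scalemxAr.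
have sa i : s 0 i * s 0 i = a * s 0 i.
  by have /matrixP/(_ i i) := D; rewrite mulmx_diag !mxE eqxx !mulr1n.
have -> : map_mx sqrtC s = (sqrtC a)^-1 *: s.
  apply/rowP => i; rewrite !mxE.
  have [->|s0] := eqVneq (s 0 i) 0; first by rewrite sqrtC0 mulr0.
  have -> : s 0 i = a by apply: (mulIf s0); exact: sa.
  by rewrite sqrtC_divl.
rewrite linearZ /= -scalemxAr -scalemxAl -E scalerA; congr (_ *: _).
exact: sqrtC_divl.
Qed.

(** A pure state is its own square root, and sandwiching [eta] between two copies gives the overlap
    times [ketbra v]. The root of that has trace [sqrtC] of the overlap, which the outer square
    undoes. *)
Lemma fidelity_pure n (v : 'cV[C]_n) (eta : 'M[C]_n) : unit_vector v ->
  fidelity (ketbra v) eta = complex.Re (\tr (ketbra v *m eta)).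
Proof.
move=> v1; have Ph := adjmx_ketbra v; have PP := ketbra_idem v1.
rewrite /fidelity.
have -> : sqrtmx (ketbra v) = ketbra v.
  by rewrite -{1}[ketbra v]scale1r sqrtmx_scale_proj // sqrtC1 scale1r.
have -> : ketbra v *m eta *m ketbra v = \tr (ketbra v *m eta) *: ketbra v.
  have e : v ^t* *m eta *m v = (\tr (ketbra v *m eta))%:M.
    by rewrite [LHS]mx11_scalar -trace_mx11 mxtrace_mulC mulmxA.
  rewrite -[LHS]/(v *m v ^t* *m eta *m (v *m v ^t*)) !mulmxA -2!(mulmxA v) e.
  by rewrite mul_mx_scalar -scalemxAl mulmxA.
rewrite sqrtmx_scale_proj // mxtraceZ exprMn sqrtCK.
have -> : \tr (ketbra v) = 1.
  by rewrite /ketbra mxtrace_mulC v1 mxtrace1.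
by rewrite expr1n mulr1.
Qed.
End StateVectors.

(** * Unitary evolution *)

Lemma cvg_mx_entries (K : numFieldType) m n (u : nat -> 'M[K]_(m, n)) (l : 'M[K]_(m, n)) :
  (forall i j, (fun k => u k i j) @ \oo --> (l i j : K^o)) -> limn u = l.
Proof.
move=> ul; apply: cvg_lim; first exact: norm_hausdorff.
apply/cvg_ballP => e e0.
have : \forall k \near \oo, forall ij : 'I_m * 'I_n, `|l ij.1 ij.2 - u k ij.1 ij.2| < e.
  by apply: filter_forall => -[i j]; exact: (cvgr_dist_lt _ _ (ul i j)).
by apply: filterS => k uk; split=> // i j; exact: (uk (i, j)).
Qed.

Section Evolution.
Variable R : realType.
Local Notation C := R[i].

Lemma cvg_complex (a b : nat -> R) (l m : R) : a @ \oo --> l -> b @ \oo --> m ->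
  (fun n => a n +i* b n : C^o) @ \oo --> (l +i* m : C^o).
Proof.
move=> al bm; apply/(@cvgrPdist_lt C C^o) => /= -[e e'].
(* A positive complex tolerance has zero imaginary part, so it is a positive real. *)
rewrite ltcE /= => /andP[/eqP -> e0].
near=> n; rewrite normc_def ltcE /= eqxx /=.
have an : `|l - a n| < e / 2 by near: n; apply: (cvgr_dist_lt _ _ al); rewrite divr_gt0.
have bn : `|m - b n| < e / 2 by near: n; apply: (cvgr_dist_lt _ _ bm); rewrite divr_gt0.
rewrite -(ger0_norm (ltW e0)) -sqrtr_sqr ltr_sqrt ?exprn_gt0 //.
have sq (x : R) : `|x| < e / 2 -> x ^+ 2 < e ^+ 2 / 2.
  by rewrite ltr_norml => /andP[h1 h2]; nra.
by rewrite [ltRHS](_ : _ = e ^+ 2 / 2 + e ^+ 2 / 2) ?ltrD ?sq //; lra.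
Unshelve. all: by end_near. Qed.

(** The powers of ['i] are real for even [j] and imaginary for odd [j], with the signs of the cosine
    and sine series. *)
Lemma expi_coeff (x : R) j :
  (j`!)%:R^-1 * ('i * x%:C) ^+ j = cos_coeff x j +i* sin_coeff x j.
Proof.
have iX : 'i ^+ j = ((~~ odd j)%:R * (-1) ^+ j./2) +i* ((odd j)%:R * (-1) ^+ j.-1./2) :> C.
  rewrite -{1}(odd_double_half j) exprD -muln2 mulnC exprM sqr_i.
  have -> : (-1 : C) ^+ j./2 = ((-1) ^+ j./2)%:C by rewrite rmorphXn /= rmorphN1.
  case oj: (odd j) => /=; last first.
    by rewrite expr0 mul1r mul1r mul0r.
  rewrite expr1 mul0r mul1r -[in RHS](odd_double_half j) oj /= doubleK.
  by apply/eqP; rewrite eq_complex /=; apply/andP; split; apply/eqP; ring.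
rewrite /cos_coeff /sin_coeff /= exprMn -rmorphXn iX /=.
have -> : (j`!%:R^-1 : C) = (j`!%:R^-1)%:C by rewrite fmorphV /= rmorph_nat.
by apply/eqP; rewrite eq_complex -?exprnP /=; apply/andP; split; apply/eqP; ring.
Qed.

(** This is [e^{ix}], given through cosine and sine so that real calculus differentiates it;
    [cvg_expi] links it to the exponential series. *)
Definition expi (x : R) : C := cos x +i* sin x.

Lemma cvg_expi x : series (fun j => (j`!)%:R^-1 * ('i * x%:C) ^+ j) @ \oo --> (expi x : C^o).
Proof.
have cc := @is_cvg_series_cos_coeff R x; have sc := @is_cvg_series_sin_coeff R x.
have -> : expi x = limn (series (cos_coeff x)) +i* limn (series (sin_coeff x)).
  by rewrite /expi !unlock.
rewrite (_ : series _ = fun n => series (cos_coeff x) n +i* series (sin_coeff x) n).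
  exact: cvg_complex.
apply/funext => n; rewrite /series /=; elim: n => [|n IHn].
  by rewrite !big_geq.
by rewrite !big_nat_recr //= IHn expi_coeff; apply/eqP; rewrite eq_complex /= !eqxx.
Qed.
End Evolution.

(** * Algebra of matrices diagonal in a common basis *)

Lemma similar_mulmx (K : pzRingType) n (P Q D E : 'M[K]_n) : P *m Q = 1%:M ->
  (Q *m D *m P) *m (Q *m E *m P) = Q *m (D *m E) *m P.
Proof. by move=> PQ; rewrite !mulmxA -(mulmxA _ P Q) PQ mulmx1. Qed.

Lemma similar_diag_mxM (K : pzRingType) n (P Q : 'M[K]_n) (a b : 'rV[K]_n) :
  P *m Q = 1%:M ->
  (Q *m diag_mx a *m P) *m (Q *m diag_mx b *m P) =
    Q *m diag_mx (\row_j (a 0 j * b 0 j)) *m P.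
Proof. by move=> PQ; rewrite similar_mulmx // mulmx_diag. Qed.

Lemma similar_diag_mxZ (K : comPzRingType) n (P Q : 'M[K]_n) (a : 'rV[K]_n) c :
  c *: (Q *m diag_mx a *m P) = Q *m diag_mx (c *: a) *m P.
Proof. by rewrite scalemxAl scalemxAr -linearZ. Qed.

Lemma similar_diag_mxX (K : comUnitRingType) n (P : 'M[K]_n) (a : 'rV[K]_n) q :
  P \in unitmx -> (invmx P *m diag_mx a *m P) ^+ q =
    invmx P *m diag_mx (map_mx (fun x => x ^+ q) a) *m P.
Proof.
move=> Pu; elim: q => [|q IHq].
  rewrite expr0 (_ : diag_mx _ = 1%:M) ?mulmx1 ?mulVmx //.
  by rewrite -diag_const_mx; congr diag_mx; apply/rowP => k; rewrite !mxE expr0.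
rewrite exprS IHq -[LHS]/(_ *m _) similar_mulmx ?mulmxV // mulmx_diag.
by congr (_ *m diag_mx _ *m _); apply/rowP => k; rewrite !mxE exprS.
Qed.

(** * Entrywise derivatives of complex matrices depending on a real variable *)

Section MatrixDerivative.
Variable R : realType.
Local Notation C := R[i].

Definition cderiv (f : R -> C) (t : R) (l : C) : Prop :=
  is_derive t (1 : R) (fun s => complex.Re (f s)) (complex.Re l) /\
  is_derive t (1 : R) (fun s => complex.Im (f s)) (complex.Im l).

Definition mderiv m n (F F' : R -> 'M[C]_(m, n)) : Prop :=
  forall t i j, cderiv (fun s => F s i j) t (F' t i j).

Lemma cderiv_eq (f g : R -> C) t l l' : cderiv f t l -> f =1 g -> l = l' -> cderiv g t l'.
Proof. by move=> fl /funext <- <-. Qed.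

Lemma mderiv_eq m n (F F' G G' : R -> 'M[C]_(m, n)) :
  mderiv F F' -> F =1 G -> F' =1 G' -> mderiv G G'.
Proof. by move=> FF' /funext <- /funext <-. Qed.

Lemma cderiv_cst (c : C) t : cderiv (fun=> c) t 0.
Proof. by split; exact: is_derive_cst. Qed.

Lemma cderivB f g t (l m : C) : cderiv f t l -> cderiv g t m ->
  cderiv (fun s => f s - g s) t (l - m).
Proof.
move=> [f1 f2] [g1 g2]; split; (apply: is_derive_eq; last by rewrite raddfB).
  by under eq_fun do rewrite raddfB; exact: is_deriveB.
by under eq_fun do rewrite raddfB; exact: is_deriveB.
Qed.

Lemma cderivD f g t (l m : C) : cderiv f t l -> cderiv g t m ->
  cderiv (fun s => f s + g s) t (l + m).
Proof.
move=> [f1 f2] [g1 g2]; split; (apply: is_derive_eq; last by rewrite raddfD).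
  by under eq_fun do rewrite raddfD; exact: is_deriveD.
by under eq_fun do rewrite raddfD; exact: is_deriveD.
Qed.

Lemma is_derive_fun_sum n (h : 'I_n -> R -> R) (t : R) dh :
  (forall k, is_derive t (1 : R) (h k) (dh k)) ->
  is_derive t (1 : R) (fun s => \sum_k h k s) (\sum_k dh k).
Proof.
by move=> hd; have := is_derive_sum hd; rewrite fct_sumE.
Qed.

Lemma cderiv_sum n (f : 'I_n -> R -> C) t l : (forall k, cderiv (f k) t (l k)) ->
  cderiv (fun s => \sum_k f k s) t (\sum_k l k).
Proof.
move=> fl; split; rewrite raddf_sum /=.
  by under eq_fun do rewrite raddf_sum; apply: is_derive_fun_sum => k; case: (fl k).
by under eq_fun do rewrite raddf_sum; apply: is_derive_fun_sum => k; case: (fl k).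
Qed.

Lemma cderivM f g t (l m : C) : cderiv f t l -> cderiv g t m ->
  cderiv (fun s => f s * g s) t (l * g t + f t * m).
Proof.
have reM (x y : C) : complex.Re (x * y) = complex.Re x * complex.Re y - complex.Im x * complex.Im y.
  by case: x y => ? ? [].
have imM (x y : C) : complex.Im (x * y) = complex.Re x * complex.Im y + complex.Im x * complex.Re y.
  by case: x y => ? ? [].
have reD (x y : C) : complex.Re (x + y) = complex.Re x + complex.Re y by case: x y => ? ? [].
have imD (x y : C) : complex.Im (x + y) = complex.Im x + complex.Im y by case: x y => ? ? [].
move=> [f1 f2] [g1 g2]; split.
  under eq_fun do rewrite reM;
    apply: (is_derive_eq (is_deriveB (is_deriveM f1 g1) (is_deriveM f2 g2))).
  by rewrite reD !reM /GRing.scale /=; ring.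
under eq_fun do rewrite imM;
  apply: (is_derive_eq (is_deriveD (is_deriveM f1 g2) (is_deriveM f2 g1))).
by rewrite imD !imM /GRing.scale /=; ring.
Qed.

Lemma mderiv_cst m n (A : 'M[C]_(m, n)) : mderiv (fun=> A) (fun=> 0).
Proof. by move=> t i j; rewrite mxE; exact: cderiv_cst. Qed.

Lemma mderivB m n (F F' G G' : R -> 'M[C]_(m, n)) : mderiv F F' -> mderiv G G' ->
  mderiv (fun t => F t - G t) (fun t => F' t - G' t).
Proof.
move=> FF' GG' t i j; apply: cderiv_eq (cderivB (FF' t i j) (GG' t i j)) _ _ => [s|];
  by rewrite !mxE.
Qed.

Lemma mderivD m n (F F' G G' : R -> 'M[C]_(m, n)) : mderiv F F' -> mderiv G G' ->
  mderiv (fun t => F t + G t) (fun t => F' t + G' t).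
Proof.
move=> FF' GG' t i j; apply: cderiv_eq (cderivD (FF' t i j) (GG' t i j)) _ _ => [s|];
  by rewrite !mxE.
Qed.

Lemma mderivM m n p (F F' : R -> 'M[C]_(m, n)) (G G' : R -> 'M[C]_(n, p)) :
  mderiv F F' -> mderiv G G' ->
  mderiv (fun t => F t *m G t) (fun t => F' t *m G t + F t *m G' t).
Proof.
move=> FF' GG' t i j.
apply: cderiv_eq (cderiv_sum (fun k => cderivM (FF' t i k) (GG' t k j))) _ _ => [s|].
  by rewrite mxE.
by rewrite !mxE -big_split.
Qed.

Lemma mderivMl m n p (A : 'M[C]_(m, n)) (G G' : R -> 'M[C]_(n, p)) :
  mderiv G G' -> mderiv (fun t => A *m G t) (fun t => A *m G' t).
Proof.
move=> /(mderivM (mderiv_cst A)) /mderiv_eq; apply => // t.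
by rewrite mul0mx add0r.
Qed.

Lemma mderivMr m n p (F F' : R -> 'M[C]_(m, n)) (A : 'M[C]_(n, p)) :
  mderiv F F' -> mderiv (fun t => F t *m A) (fun t => F' t *m A).
Proof.
move=> /mderivM/(_ (mderiv_cst A)) /mderiv_eq; apply => // t.
by rewrite mulmx0 addr0.
Qed.

Lemma mderiv_adj m n (F F' : R -> 'M[C]_(m, n)) : mderiv F F' ->
  mderiv (fun t => (F t) ^t*) (fun t => (F' t) ^t*).
Proof.
move=> FF' t i j; have [f1 f2] := FF' t j i.
have re (x : C) : complex.Re (Num.conj x) = complex.Re x by case: x.
have im (x : C) : complex.Im (Num.conj x) = - complex.Im x by case: x.
split.
  by under eq_fun do rewrite !mxE re; rewrite !mxE re.
by under eq_fun do rewrite !mxE im; rewrite !mxE im; exact: is_deriveN.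
Qed.

Lemma mderiv_tens1 m n d (F F' : R -> 'M[C]_(m, n)) : mderiv F F' ->
  mderiv (fun t => F t *t (1%:M : 'M_d)) (fun t => F' t *t (1%:M : 'M_d)).
Proof.
move=> FF' t i j.
apply: cderiv_eq (cderivM (FF' t _ _) (cderiv_cst _ t)) _ _ => [s|].
  by rewrite mxE.
by rewrite mulr0 addr0 [RHS]mxE.
Qed.

(** The derivative at 0 is two-sided and known to exist, so its value can be read off on the right,
    where [F] is constantly 0. *)
Lemma mderiv0_vanish_right m n (F F' : R -> 'M[C]_(m, n)) : mderiv F F' ->
  (forall t, 0 <= t -> F t = 0) -> F' 0 = 0.
Proof.
move=> FF' F0; apply/matrixP => i j; rewrite mxE.
have der (f : R -> R) d : is_derive (0 : R) (1 : R) f d -> (forall t, 0 <= t -> f t = 0) -> d = 0.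
  move=> df f0; have fE (t : R) : 0 <= t -> f t = (fun=> 0) t by exact: f0.
  have := derive1_eq_right fE (is_derive_cst _ _ _).
  by rewrite derive1E derive_val => -[].
have [d1 d2] := FF' 0 i j.
have re0 : complex.Re (F' 0 i j) = 0 by apply: (der _ _ d1) => t /F0 ->; rewrite mxE.
have im0 : complex.Im (F' 0 i j) = 0 by apply: (der _ _ d2) => t /F0 ->; rewrite mxE.
by apply/eqP; rewrite eq_complex re0 im0 !eqxx.
Qed.

(** The real part of the Hermitian inner product; being bilinear over [R], it obeys the product
    rule. *)
Definition rdot n (u v : 'cV[C]_n) : R :=
  \sum_i (complex.Re (u i 0) * complex.Re (v i 0) + complex.Im (u i 0) * complex.Im (v i 0)).

Lemma rdotvv n (v : 'cV[C]_n) : rdot v v = sqnorm v.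
Proof. by apply: eq_bigr => i _; rewrite !expr2. Qed.

Lemma rdot0l n (v : 'cV[C]_n) : rdot 0 v = 0.
Proof. by rewrite /rdot big1 // => i _; rewrite !mxE /= !mul0r addr0. Qed.

Lemma rdot0r n (v : 'cV[C]_n) : rdot v 0 = 0.
Proof. by rewrite /rdot big1 // => i _; rewrite !mxE /= !mulr0 addr0. Qed.

Lemma is_derive_rdot n (F F' G G' : R -> 'cV[C]_n) t : mderiv F F' -> mderiv G G' ->
  is_derive t (1 : R) (fun s => rdot (F s) (G s)) (rdot (F' t) (G t) + rdot (F t) (G' t)).
Proof.
move=> FF' GG'; rewrite /rdot -big_split /=.
apply: is_derive_fun_sum => i; have [f1 f2] := FF' t i 0; have [g1 g2] := GG' t i 0.
apply: (is_derive_eq (is_deriveD (is_deriveM f1 g1) (is_deriveM f2 g2))).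
by rewrite /GRing.scale /=; ring.
Qed.

End MatrixDerivative.

(** * Spectral form, unitarity and derivative of the evolution operator *)

Section Evolution.
Variable R : realType.
Local Notation C := R[i].

(** Conjugation by [P] acts term by term on the exponential series, so each entry is a fixed finite
    combination of scalar series. *)
Lemma expmx_diagonalizable n (P A : 'M[C]_n) (a e : 'rV[C]_n) : P \in unitmx ->
  A = invmx P *m diag_mx a *m P ->
  (forall k, series (fun j => (j`!)%:R^-1 * a 0 k ^+ j) @ \oo --> (e 0 k : C^o)) ->
  expmx A = invmx P *m diag_mx e *m P.
Proof.
move=> Pu AE ae; apply: cvg_mx_entries => i j.
have AX q : A ^+ q = invmx P *m diag_mx (map_mx (fun x => x ^+ q) a) *m P.
  by rewrite AE; exact: similar_diag_mxX.
have -> : (fun k => series (fun q => (q`!)%:R^-1 *: A ^+ q) k i j) =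
    (fun k => \sum_l invmx P i l * series (fun q => (q`!)%:R^-1 * a 0 l ^+ q) k * P l j : C^o).
  apply/funext => k; rewrite /series /= summxE.
  under [RHS]eq_bigr do rewrite mulr_sumr mulr_suml.
  rewrite exchange_big /=; apply: eq_bigr => q _.
  rewrite AX !mxE mulr_sumr; apply: eq_bigr => l _.
  by rewrite mul_mx_diag !mxE; ring.
have -> : (invmx P *m diag_mx e *m P) i j = \sum_l invmx P i l * e 0 l * P l j.
  by rewrite mxE; apply: eq_bigr => l _; rewrite mul_mx_diag mxE.
elim: (index_enum _) => [|l s IHs].
  by under eq_fun do rewrite big_nil; rewrite big_nil; exact: cvg_cst.
under eq_fun do rewrite big_cons; rewrite big_cons.
apply: cvgD IHs; apply: cvgM; last exact: cvg_cst.
by apply: cvgM; [exact: cvg_cst | exact: ae].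
Qed.

(** Hermitian matrices have a unitary eigenbasis and real spectrum. One [P] serves all [t], so only
    the diagonal depends on time. *)
Lemma evolution_spectral n (H : 'M[C]_n) : hermitian_op H ->
  exists (P : 'M[C]_n) (r : 'I_n -> R),
  [/\ P ^t* *m P = 1%:M, P *m P ^t* = 1%:M,
      H = P ^t* *m diag_mx (\row_k (r k)%:C) *m P &
      forall t, evolution H t = P ^t* *m diag_mx (\row_k expi (- (t * r k))) *m P].
Proof.
move=> Hh; pose P := spectralmx H; pose s := spectral_diag H.
have Hsym : H \is hermsymmx by apply/is_hermitianmxP; rewrite expr0 scale1r Hh.
have HE : H = invmx P *m diag_mx s *m P.
  by apply/orthomx_spectralP; exact: hermitian_normalmx.
have Pu : P \is unitarymx := spectral_unitarymx H.
have PV := invmx_unitary Pu.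
have sE k : s 0 k = (complex.Re (s 0 k))%:C.
  have /mxOverP/(_ 0 k) := hermitian_spectral_diag_real Hsym.
  by rewrite -/s; case: (s 0 k) => a b; rewrite complex_real => /eqP ->.
exists P, (fun k => complex.Re (s 0 k)); split.
- by rewrite -PV mulVmx ?unitarymx_unit.
- exact/unitarymxP.
- have <- : s = \row_k (complex.Re (s 0 k))%:C by apply/rowP => k; rewrite mxE -sE.
  by rewrite -PV.
move=> t; rewrite -PV /evolution.
apply: (@expmx_diagonalizable _ _ _ (- ('i * t%:C) *: s)); first exact: unitarymx_unit.
  by rewrite {1}HE linearZ /= -scalemxAr -scalemxAl.
move=> k; rewrite !mxE {1}sE.
have -> : - ('i * t%:C) * (complex.Re (s 0 k))%:C = 'i * (- (t * complex.Re (s 0 k)))%:C :> C.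
  by rewrite rmorphN rmorphM /=; ring.
exact: cvg_expi.
Qed.

Lemma expi0 : expi 0 = 1 :> C.
Proof. by rewrite /expi cos0 sin0. Qed.

Lemma conj_expi (x : R) : Num.conj (expi x) = expi (- x).
Proof. by rewrite /expi cosN sinN. Qed.

Lemma expiNM (x : R) : expi (- x) * expi x = 1.
Proof.
rewrite /expi cosN sinN; apply/eqP; rewrite eq_complex /=.
have := cos2Dsin2 x; rewrite !expr2 => e; apply/andP; split; apply/eqP; last by ring.
by rewrite mulNr opprK.
Qed.

Lemma cderiv_expi (r t : R) :
  cderiv (fun s => expi (- (s * r))) t (- 'i * r%:C * expi (- (t * r))).
Proof.
have lin : is_derive t (1 : R) (fun s : R => - (s * r)) (- r).
  apply: is_derive_eq (is_deriveN (is_deriveM (is_derive_id t 1) (is_derive_cst r t 1))) _.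
  by rewrite /GRing.scale /=; ring.
have c := is_derive1_comp (f := cos) (is_derive_cos _) lin.
have s := is_derive1_comp (f := sin) (is_derive_sin _) lin.
by split; [apply: (is_derive_eq c) | apply: (is_derive_eq s)] => /=; ring.
Qed.

Section HermitianEvolution.
Variables (n : nat) (H : 'M[C]_n) (Hh : hermitian_op H).

Lemma evolution0 : evolution H 0 = 1%:M.
Proof.
have [P [r [PP _ _ ->]]] := evolution_spectral Hh.
rewrite (_ : diag_mx _ = 1%:M) ?mulmx1 //.
by apply/matrixP => i j; rewrite !mxE mul0r oppr0 expi0.
Qed.

Lemma adj_evolution t : (evolution H t) ^t* = evolution H (- t).
Proof.
have [P [r [_ _ _ EE]]] := evolution_spectral Hh.
rewrite !EE !adjmxM trmxCK mulmxA tr_diag_mx map_diag_mx; congr (_ *m diag_mx _ *m _).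
by apply/rowP => k; rewrite !mxE /= conj_expi mulNr.
Qed.

Lemma evolutionNM t : evolution H (- t) *m evolution H t = 1%:M.
Proof.
have [P [r [PP PP' _ EE]]] := evolution_spectral Hh.
rewrite !EE similar_diag_mxM //.
rewrite (_ : diag_mx _ = 1%:M) ?mulmx1 //.
by apply/matrixP => i j; rewrite !mxE mulNr expiNM.
Qed.

Lemma mderiv_evolution : mderiv (evolution H) (fun t => - 'i *: H *m evolution H t).
Proof.
have [P [r [_ PP' HE EE]]] := evolution_spectral Hh.
have D : mderiv (fun t => diag_mx (\row_k expi (- (t * r k))))
    (fun t => diag_mx (\row_k (- 'i * (r k)%:C * expi (- (t * r k))))).
  move=> t i j; case: (eqVneq i j) => [<-|/negPf ij].
    by apply: cderiv_eq (cderiv_expi (r i) t) _ _ => [s|]; rewrite !mxE eqxx.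
  by apply: cderiv_eq (cderiv_cst 0 t) _ _ => [s|]; rewrite !mxE ij.
have -> : evolution H = fun t => P ^t* *m diag_mx (\row_k expi (- (t * r k))) *m P.
  exact/funext.
have -> : (fun t => - 'i *: H *m (P ^t* *m diag_mx (\row_k expi (- (t * r k))) *m P)) =
    (fun t => P ^t* *m diag_mx (\row_k (- 'i * (r k)%:C * expi (- (t * r k)))) *m P).
  apply/funext => t.
  have -> : - 'i *: H = P ^t* *m diag_mx (\row_k (- 'i * (r k)%:C)) *m P.
    have -> : \row_k (- 'i * (r k)%:C) = - 'i *: \row_k (r k)%:C.
      by apply/rowP => k; rewrite !mxE.
    by rewrite {1}HE similar_diag_mxZ.
  have -> : \row_k (- 'i * (r k)%:C * expi (- (t * r k))) =
      \row_j ((\row_k (- 'i * (r k)%:C)) 0 j * (\row_k expi (- (t * r k))) 0 j).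
    by apply/rowP => k; rewrite !mxE.
  exact: similar_diag_mxM.
exact: (mderivMr P (mderivMl (P ^t*) D)).
Qed.
End HermitianEvolution.
End Evolution.

(** * Leakage out of the decoherence-free subspace *)

(** The duality characterising the partial trace: indices of the product are pairs, and the identity
    on the bath forces equal bath indices. *)
Lemma mxtrace_partial_trace (R : realType) m d (A : 'M[R[i]]_m) (Y : 'M[R[i]]_(m * d)) :
  \tr (A *m partial_trace_bath Y) = \tr ((A *t (1%:M : 'M_d)) *m Y).
Proof.
have bigI (f : 'I_(m * d) -> R[i]) : \sum_k f k = \sum_i \sum_l f (mxtens_index (i, l)).
  rewrite pair_bigA /= (reindex (@mxtens_index m d)) /=; last first.
    by exists (@mxtens_unindex m d) => k _; [exact: mxtens_indexK | exact: mxtens_unindexK].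
  by apply: eq_bigr => -[].
rewrite /mxtrace bigI; apply: eq_bigr => i _.
rewrite mxE; under eq_bigr do rewrite mxE mulr_sumr.
rewrite exchange_big /=; apply: eq_bigr => l _.
rewrite mxE bigI; apply: eq_bigr => j _.
rewrite (bigD1 l) //= tensmxE mxE eqxx mulr1 big1 ?addr0 // => l' /negPf l'l.
by rewrite tensmxE mxE eq_sym l'l mulr0 mul0r.
Qed.

(** Used at [t = 0] with [A], [W] the parts of [-iH] from [H0] and [V], [P] the code projector and
    [D] its derivative: the difference of perturbed and unperturbed leakage derivatives. *)
Lemma mulmx_affine_sub (K : comNzRingType) n (A W D P : 'M[K]_n) (v : 'cV[K]_n) :
  (A + W) *m v - (D *m v + P *m ((A + W) *m v)) - (A *m v - (D *m v + P *m (A *m v))) =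
    W *m v - P *m (W *m v).
Proof.
rewrite mulmxDl mulmxDr; move: (A *m v) (W *m v) (D *m v) => x y z.
move: (P *m x) (P *m y) => a b.
by apply/matrixP => i j; rewrite !mxE; ring.
Qed.

Lemma mulmx_conj_derivation (K : pzRingType) n (A B S T X : 'M[K]_n) :
  A *m S *m X *m T + S *m X *m (T *m B) = A *m (S *m X *m T) + S *m X *m T *m B.
Proof. by rewrite !mulmxA. Qed.

Lemma adjmx_scale_herm_mul (K : numClosedFieldType) n a (A E : 'M[K]_n) : A ^t* = A ->
  (a *: A *m E) ^t* = E ^t* *m (Num.conj a *: A).
Proof. by move=> Ah; rewrite adjmxM adjmxZ Ah. Qed.

Lemma conjNi (R : realType) : Num.conj (- 'i : R[i]) = 'i.
Proof. by apply/eqP; rewrite eq_complex /= opprK oppr0 !eqxx. Qed.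

Section Leakage.
Variables (R : realType) (m d : nat).
Local Notation C := R[i].
Variables (HS : 'M[C]_m) (H0 V : 'M[C]_(m * d)).
Hypotheses (hHS : hermitian_op HS) (hH0 : hermitian_op H0) (hV : hermitian_op V).
Variables (psi : 'cV[C]_m) (phi0 : 'cV[C]_d).
Hypotheses (psi1 : unit_vector psi) (phi1 : unit_vector phi0).
Hypothesis dfs : forall t : R, 0 <= t ->
  reduced_state H0 psi phi0 t = evolution HS t *m ketbra psi *m evolution HS (- t).

Let Psi : 'cV[C]_(m * d) := psi *t phi0.

Lemma sqnorm_Psi : sqnorm Psi = 1.
Proof. by rewrite sqnorm_tens !(unit_vectorE _).1 // mulr1. Qed.

Let H (eps : R) := H0 + eps%:C *: V.

Lemma hermitian_perturbed eps : hermitian_op (H eps).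
Proof.
rewrite /hermitian_op adjmxD adjmxZ hH0 hV; congr (_ + _ *: _).
by apply/eqP; rewrite eq_complex /= oppr0 !eqxx.
Qed.
Let hH := hermitian_perturbed.

Definition system_proj t := evolution HS t *m ketbra psi *m evolution HS (- t).
Definition code_proj t : 'M[C]_(m * d) := system_proj t *t (1%:M : 'M_d).
Definition global_state eps t : 'cV[C]_(m * d) := evolution (H eps) t *m Psi.
Definition leakage eps t := global_state eps t - code_proj t *m global_state eps t.

Lemma unit_evolved t : unit_vector (evolution HS t *m psi).
Proof.
apply/unit_vectorE; rewrite sqnorm_isometry; first exact/unit_vectorE.
by rewrite adj_evolution // evolutionNM.
Qed.

Lemma system_projE t : system_proj t = ketbra (evolution HS t *m psi).
Proof. by rewrite /system_proj /ketbra adjmxM adj_evolution // !mulmxA. Qed.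

Lemma code_proj_adj t : (code_proj t) ^t* = code_proj t.
Proof. by rewrite /code_proj adjmx_tens adjmx1 system_projE adjmx_ketbra. Qed.

Lemma code_proj_idem t : code_proj t *m code_proj t = code_proj t.
Proof.
rewrite /code_proj tensmx_mul mulmx1 system_projE.
by rewrite (ketbra_idem (unit_evolved t)).
Qed.

Lemma sqnorm_global_state eps t : sqnorm (global_state eps t) = 1.
Proof.
by rewrite sqnorm_isometry ?sqnorm_Psi // adj_evolution ?evolutionNM //; exact: hH.
Qed.

(** By [fidelity_pure] and the duality of the partial trace, the fidelity is the squared norm of the
    projected global state; Pythagoras and normalisation give the complement. *)
Lemma fidelity_leakage eps t : 0 <= t ->
  dynamical_fidelity H0 V psi phi0 eps t = 1 - sqnorm (leakage eps t).
Proof.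
move=> t0; rewrite /dynamical_fidelity dfs // -/(system_proj t) system_projE.
rewrite fidelity_pure; last exact: unit_evolved.
rewrite -system_projE mxtrace_partial_trace -/(code_proj t) -/(H eps).
rewrite -(sqnorm_global_state eps t) (sqnorm_proj _ (code_proj_adj t) (code_proj_idem t)).
rewrite addrK.
have -> : evolution (H eps) t *m ketbra Psi *m evolution (H eps) (- t) = ketbra (global_state eps t).
  by rewrite /ketbra /global_state adjmxM adj_evolution ?mulmxA //; exact: hH.
by rewrite (mxtrace_proj_ketbra _ (code_proj_adj t) (code_proj_idem t)).
Qed.

(** At [eps = 0] both arguments of the fidelity are the same pure state, so it equals 1 and the
    leakage has norm 0. *)
Lemma leakage_unperturbed t : 0 <= t -> leakage 0 t = 0.
Proof.
move=> t0; apply: sqnorm0_eq0; have := fidelity_leakage 0 t0.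
rewrite /dynamical_fidelity scale0r addr0 dfs // -/(system_proj t) system_projE.
have u1 := unit_evolved t.
rewrite fidelity_pure // ketbra_idem // /ketbra mxtrace_mulC u1 mxtrace1 /=.
by move=> /eqP; rewrite eq_sym subr_eq addrC -subr_eq subrr => /eqP.
Qed.

(** The von Neumann equation, from the product rule applied to [U X U^*] with [X] fixed. *)
Lemma mderiv_system_proj : mderiv system_proj
  (fun t => - 'i *: HS *m system_proj t + system_proj t *m ('i *: HS)).
Proof.
have dS := mderiv_evolution hHS; have := mderivM (mderivMr (ketbra psi) dS) (mderiv_adj dS).
have -> : (fun t => evolution HS t *m ketbra psi *m (evolution HS t) ^t*) = system_proj.
  by apply/funext => t; rewrite adj_evolution.
have -> : (fun t => - 'i *: HS *m evolution HS t *m ketbra psi *m (evolution HS t) ^t* +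
      evolution HS t *m ketbra psi *m (- 'i *: HS *m evolution HS t) ^t*) =
    (fun t => - 'i *: HS *m system_proj t + system_proj t *m ('i *: HS)).
  apply/funext => t.
  have -> : (- 'i *: HS *m evolution HS t) ^t* = evolution HS (- t) *m ('i *: HS).
    rewrite (adjmx_scale_herm_mul (- 'i) (evolution HS t) hHS).
    rewrite (adj_evolution hHS) conjNi.
    reflexivity.
  by rewrite adj_evolution //; exact: mulmx_conj_derivation.
by [].
Qed.

Definition leakage' eps t := - 'i *: H eps *m global_state eps t -
  (((- 'i *: HS *m system_proj t + system_proj t *m ('i *: HS)) *t (1%:M : 'M_d))
     *m global_state eps t + code_proj t *m (- 'i *: H eps *m global_state eps t)).

Lemma mderiv_global_state eps :
  mderiv (global_state eps) (fun t => - 'i *: H eps *m global_state eps t).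
Proof.
have := mderivMr Psi (mderiv_evolution (hH eps)).
by rewrite [X in mderiv _ X](_ : _ = fun t => - 'i *: H eps *m global_state eps t) //;
  apply/funext => t; rewrite mulmxA.
Qed.

Lemma mderiv_leakage eps : mderiv (leakage eps) (leakage' eps).
Proof.
have du := mderiv_global_state eps.
have dw := mderivB du (mderivM (mderiv_tens1 (d := d) mderiv_system_proj) du).
exact: dw.
Qed.

(** Existence suffices: at [t = 0] the second derivative is only paired with the leakage, which
    vanishes there. *)
Lemma derivable_leakage' eps : exists w2, mderiv (leakage' eps) w2.
Proof.
have du := mderivMl (- 'i *: H eps) (mderiv_global_state eps).
have dP := mderiv_system_proj.
have d1 := mderivD (mderivMl (- 'i *: HS) dP) (mderivMr ('i *: HS) dP).
have d2 := mderivM (mderiv_tens1 (d := d) d1) (mderiv_global_state eps).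
have d3 := mderivM (mderiv_tens1 (d := d) dP) du.
have dw := mderivB du (mderivD d2 d3).
by eexists; exact: dw.
Qed.

(** Subtracting the unperturbed derivative, which is 0 by [mderiv0_vanish_right], cancels [H0] and
    the motion of the projector and leaves only the [V] term. *)
Lemma leakage'0 eps :
  leakage' eps 0 = (- 'i * eps%:C) *: (V *m Psi - code_proj 0 *m (V *m Psi)).
Proof.
have L0 := mderiv0_vanish_right (mderiv_leakage 0) leakage_unperturbed.
rewrite -[LHS]subr0 -L0 /leakage' /global_state !evolution0 //; try exact: hH.
have -> : - 'i *: H eps = - 'i *: H 0 + (- 'i * eps%:C) *: V.
  by rewrite /H scale0r addr0 scalerDr scalerA.
by rewrite !mul1mx mulmx_affine_sub -!scalemxAl -scalemxAr scalerBr.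
Qed.

Lemma derive1n2_fidelity eps :
  let K := sqnorm (V *m Psi - code_proj 0 *m (V *m Psi)) in
  let D := derive1n 2 (fun t : R => dynamical_fidelity H0 V psi phi0 eps t) 0 in
  D = - 2 * K * eps ^+ 2 \/ D = 0.
Proof.
move=> K D; have [w2 dw2] := derivable_leakage' eps.
have dw := mderiv_leakage eps.
(* At time 0 every evolution is the identity, so the leakage there does not depend on [eps]. *)
have w0 : leakage eps 0 = 0.
  have <- : leakage 0 0 = 0 by exact: leakage_unperturbed.
  by rewrite /leakage /global_state !evolution0 //; exact: hH.
have w1K : sqnorm (leakage' eps 0) = K * eps ^+ 2.
  by rewrite leakage'0 sqnormZ -/K /=; ring.
pose p t := 1 - rdot (leakage eps t) (leakage eps t).
pose p1 t := 0 - (rdot (leakage' eps t) (leakage eps t) + rdot (leakage eps t) (leakage' eps t)).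
have dp (t : R) : is_derive t 1 p (p1 t).
  by apply: is_deriveB; exact: is_derive_rdot.
have dp1 : is_derive (0 : R) 1 p1 (- 2 * K * eps ^+ 2).
  have c0 := is_derive_cst (0 : R) (0 : R) 1.
  have dd := is_deriveD (is_derive_rdot 0 dw2 dw) (is_derive_rdot 0 dw dw2).
  apply: (is_derive_eq (is_deriveB c0 dd)).
  by rewrite w0 rdot0l rdot0r rdotvv w1K; ring.
apply: derive1n2_eq_right dp _ dp1.
  by move=> t t0; rewrite fidelity_leakage // /p rdotvv.
by rewrite /p1 w0 rdot0l rdot0r addr0 subr0.
Qed.

Lemma susceptibility_bound :
  `|susceptibility H0 V psi phi0| <= sqnorm (V *m Psi).
Proof.
rewrite (sqnorm_proj _ (code_proj_adj 0) (code_proj_idem 0)).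
set K := sqnorm (V *m Psi - _).
apply: (@le_trans _ _ K); last by rewrite lerDr sqnorm_ge0.
rewrite /susceptibility.
have b := derive1n2_quadratic_or_zero derive1n2_fidelity.
(* The prefactor [1/4], the 2 from [derive1n2_quadratic_or_zero] and the modulus [2 * K] of the
   coefficient combine to [K]. *)
rewrite normrM normrN [`|4^-1|]ger0_norm ?invr_ge0 ?ler0n //.
rewrite ler_pdivrMl //; apply: le_trans b _.
by rewrite normrM normrN (ger0_norm (sqnorm_ge0 _)) -/K ger0_norm //; lra.
Qed.
End Leakage.

(** * Norm of the perturbation *)

Lemma tensmxZr (K : comPzRingType) m n p q (a : K) (A : 'M[K]_(m, n)) (B : 'M[K]_(p, q)) :
  A *t (a *: B) = a *: (A *t B).
Proof. by apply/matrixP => i j; rewrite !mxE mulrCA. Qed.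

Section PerturbationNorm.
Variable R : realType.
Local Notation C := R[i].

Lemma pauli_mx_unitary p : (pauli_mx R p) ^t* *m pauli_mx R p = 1%:M.
Proof.
case: p => /=; first by rewrite adjmx1 mulmx1.
all: apply/matrixP => i j; rewrite !mxE !big_ord_recl big_ord0 !mxE /=.
all: case: i => -[|[|//]] ?; case: j => -[|[|//]] ?.
all: apply/eqP; rewrite eq_complex /=.
all: rewrite ?(mulr0, mul0r, mulr1, mul1r, mulrN, mulNr, oppr0, opprK, addr0, add0r, subr0) !eqxx //.
Qed.

Lemma castmx_unitary m m' (e : m = m') (A : 'M[C]_m) : A ^t* *m A = 1%:M ->
  (castmx (e, e) A) ^t* *m castmx (e, e) A = 1%:M.
Proof. by case: m' / e. Qed.

Lemma tens_scalar11 m n : (1%:M : 'M[C]_m) *t (1%:M : 'M[C]_n) = 1%:M.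
Proof.
apply/matrixP => i j; case: (mxtens_indexP i) => i0 i1; case: (mxtens_indexP j) => j0 j1.
rewrite tensmxE !mxE (can_eq (@mxtens_indexK m n)) xpair_eqE.
by case: (i0 == j0); case: (i1 == j1); rewrite ?mulr0 ?mul0r ?mulr1.
Qed.

Lemma pauli_string_unitary n (a : n.-tuple pauli) :
  (pauli_string R a) ^t* *m pauli_string R a = 1%:M.
Proof.
elim: n a => [|n IHn] a /=; first by rewrite adjmx1 mulmx1.
apply: castmx_unitary; rewrite adjmx_tens tensmx_mul pauli_mx_unitary IHn.
exact: tens_scalar11.
Qed.

Lemma mx_norm_entry m n (A : 'M[C]_(m, n)) i j : `|A i j| <= `|A|.
Proof.
rewrite [leRHS]mx_normE -[`|A i j|]/(`|A (i, j).1 (i, j).2|); move: (i, j) => ij.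
by rewrite -[leLHS]nngE num_le; exact: le_bigmax.
Qed.

(** [A *m v] combines the [d] columns of [A] with coefficients of modulus at most 1. Each column has
    squared norm at most [d * M^2], and [sqnorm_sum] contributes another [d^2]. *)
Lemma sqnorm_mulmx_bound d (A : 'M[C]_d) (v : 'cV[C]_d) (M : R) :
  `|A| <= M%:C -> sqnorm v = 1 -> sqnorm (A *m v) <= d%:R ^+ 3 * M ^+ 2.
Proof.
move=> AM v1.
have entry i j : complex.Re (A i j) ^+ 2 + complex.Im (A i j) ^+ 2 <= M ^+ 2.
  have := le_trans (mx_norm_entry A i j) AM; rewrite normc_def lecR => sM.
  rewrite -[leLHS]sqr_sqrtr ?addr_ge0 ?sqr_ge0 //.
  by rewrite ler_sqr ?nnegrE ?sqrtr_ge0 // (le_trans (sqrtr_ge0 _) sM).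
have -> : A *m v = \sum_(j in 'I_d) v j 0 *: col j A.
  apply/matrixP => i k; rewrite ord1 summxE mxE; apply: eq_bigr => j _.
  by rewrite !mxE mulrC.
have -> : d%:R ^+ 3 * M ^+ 2 = #|'I_d|%:R ^+ 2 * (d%:R * M ^+ 2) :> R.
  by rewrite card_ord; ring.
apply: sqnorm_sum => j _; rewrite sqnormZ.
have vj : complex.Re (v j 0) ^+ 2 + complex.Im (v j 0) ^+ 2 <= 1.
  rewrite -v1 /sqnorm (bigD1 j) //= lerDl.
  by apply: sumr_ge0 => l _; rewrite addr_ge0 ?sqr_ge0.
apply: le_trans (ler_wpM2r (sqnorm_ge0 _) vj) _; rewrite mul1r.
apply: (@le_trans _ _ (\sum_(i < d) M ^+ 2)).
  by apply: ler_sum => i _; rewrite !mxE; exact: entry.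
by rewrite sumr_const card_ord mulr_natl.
Qed.

Variables (d : nat) (c : forall n, n.-tuple pauli -> R)
          (B : forall n, n.-tuple pauli -> 'M[C]_d).

Lemma card_occurs_le n k : k_local c B k -> (0 < n)%N ->
  (#|[pred a : n.-tuple pauli | occurs c B a]| <= (4 * n) ^ k)%N.
Proof.
move=> loc n0; apply: leq_trans (card_pauli_weight_le k n0).
by apply: subset_leq_card; apply/fintype.subsetP => a; rewrite !inE => /loc.
Qed.

(** The coefficient [c a] is moved onto the bath factor, where the coupling bound applies; the
    system factor keeps norm 1 by unitarity. Strings that do not occur contribute 0, so [sqnorm_sum]
    runs over the occurring ones. *)
Lemma sqnorm_perturbation n (psi : 'cV[C]_(2 ^ n)) (phi : 'cV[C]_d) (M : R) :
  (forall a : n.-tuple pauli, `| (c a)%:C *: B a | <= M%:C) ->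
  sqnorm psi = 1 -> sqnorm phi = 1 ->
  sqnorm (perturbation c B n *m (psi *t phi : 'cV_(2 ^ n * d))) <=
    #|[pred a : n.-tuple pauli | occurs c B a]|%:R ^+ 2 * (d%:R ^+ 3 * M ^+ 2).
Proof.
move=> cM psi1 phi1.
pose v (a : n.-tuple pauli) : 'cV[C]_(2 ^ n * d) :=
  (pauli_string R a *m psi) *t (((c a)%:C *: B a) *m phi).
have -> : perturbation c B n *m (psi *t phi : 'cV_(2 ^ n * d)) =
    \sum_(a in [pred a : n.-tuple pauli | occurs c B a]) v a.
  rewrite /perturbation mulmx_suml [LHS](bigID [pred a | occurs c B a]) /=.
  have cP a : (c a)%:C *: (pauli_string R a *t B a) *m (psi *t phi : 'cV_(2 ^ n * d)) = v a.
    have PB : (pauli_string R a *t B a) *m (psi *t phi : 'cV_(2 ^ n * d)) =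
        (pauli_string R a *m psi) *t (B a *m phi) .
      exact (tensmx_mul (pauli_string R a) (B a) psi phi).
    by rewrite -scalemxAl PB /v -scalemxAl tensmxZr.
  rewrite [X in _ + X]big1 ?addr0 => [|a]; first by apply: eq_bigr => a _; exact: cP.
  by rewrite cP /v negbK => /eqP ->; rewrite mul0mx tensmx0.
apply: sqnorm_sum => a _; rewrite sqnorm_tens sqnorm_isometry; last exact: pauli_string_unitary.
by rewrite psi1 mul1r; exact: sqnorm_mulmx_bound.
Qed.
End PerturbationNorm.

(** * The term count and the susceptibility bound *)

Theorem mainTheorem3 (R : realType) (d k : nat)
    (c : forall n : nat, n.-tuple pauli -> R)
    (B : forall n : nat, n.-tuple pauli -> 'M[R[i]]_d)
    (hindep : size_independent c B)
    (hbound : bounded_couplings c B)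
    (hlocal : k_local c B k)
    (hV : forall n : nat, hermitian_op (perturbation c B n)) :
  (exists C : nat, forall n : nat, (0 < n)%N ->
     (#|[pred a : n.-tuple pauli | occurs c B a]| <= C * n ^ k)%N)
  /\
  (exists C : R, forall n : nat, (0 < n)%N ->
     forall (HS : 'M[R[i]]_(2 ^ n)) (HB : 'M[R[i]]_d)
            (HSB : 'M[R[i]]_(2 ^ n * d)) (phi0 : 'cV[R[i]]_d)
            (D : {vspace 'cV[R[i]]_(2 ^ n)}) (psi : 'cV[R[i]]_(2 ^ n)),
       hermitian_op HS -> hermitian_op HB -> hermitian_op HSB ->
       unit_vector phi0 ->
       decoherence_free HS HB HSB phi0 D ->
       psi \in D -> unit_vector psi ->
       `| susceptibility (free_hamiltonian HS HB HSB) (perturbation c B n)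
            psi phi0 | <= C * n%:R ^+ (2 * k)).
Proof.
split.
  by exists (4 ^ k)%N => n n0; rewrite -expnMn; exact: card_occurs_le.
have [M cM] := hbound.
(* The first factor comes from squaring the count [(4 * n) ^ k], the second from
   [sqnorm_mulmx_bound]; neither depends on [n] because [M] bounds all couplings uniformly. *)
exists ((4 ^ k)%:R ^+ 2 * (d%:R ^+ 3 * M ^+ 2)) => n n0 HS HB HSB phi0 D psi.
move=> hHS hHB hHSB phi1 dfs psiD psi1.
have hH0 : hermitian_op (free_hamiltonian HS HB HSB).
  by rewrite /hermitian_op /free_hamiltonian !adjmxD !adjmx_tens !adjmx1 hHS hHB hHSB.
have dfs0 (t : R) (t0 : 0 <= t) := (dfs psi psiD psi1 t t0).1.
apply: le_trans (susceptibility_bound hHS hH0 (hV n) psi1 phi1 dfs0) _.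
have [psi1' phi1'] := ((unit_vectorE _).1 psi1, (unit_vectorE _).1 phi1).
apply: le_trans (sqnorm_perturbation (cM n) psi1' phi1') _.
rewrite [leRHS]mulrAC ler_wpM2r //; first by rewrite mulr_ge0 ?sqr_ge0 ?exprn_ge0 ?ler0n.
rewrite (mulnC 2) exprM -exprMn ler_sqr ?nnegrE ?mulr_ge0 ?exprn_ge0 ?ler0n //.
by rewrite -natrX -natrM ler_nat -expnMn; exact: card_occurs_le.
Qed.
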